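(* Let $(\Omega,\mathcal{F},\mathbb{P})$ be a probability space, $f:\mathbb{R}\to\mathbb{R}$ a non-linear function, $a>0$, $x_1\in\mathbb{R}$, and $(\xi_n)_{n\ge 1}$ a sequence of real random variables on $\Omega$ with strong mixing coefficients $\alpha(n)$. Let $(x_n)_{n\ge1}$ be defined by $$x_{n+1}=\Bigl(1-\frac{a}{n}\Bigr)x_n+\frac{a}{n}\Bigl[f(x_n)+\frac1n\,\xi_n\Bigr],\qquad n\ge 1.$$ Assume: (1) there is $c\in(0,1)$ with $|f(x)-f(y)|\le c|x-y|$ for all $x,y\in\mathbb{R}$, and $x^{\ast}$ denotes the unique fixed point of $f$; (2) there is $N$ with $0<N<+\infty$ and $|x_1-x^{\ast}|\le N$; (3) there is $p>2$ such that $\mathbb{P}\{|\xi_i|>t\}\le t^{-p}$ for all $t>0$ and all $i\ge1$; (4) there are $d\ge 1$ and $\beta>1$ such that $\alpha(n)\le d\,n^{-\beta}$ for all $n\ge1$; (5) there is $\rho>0$ with $\rho\,\frac{(\beta+1)p}{\beta+p}>2$. Then for every $\varepsilon>0$ and every $\sigma>0$ there exists a natural number $n_\sigma$ such that $$\mathbb{P}\bigl\{|x_{n_\sigma}-x^{\ast}|\le\varepsilon\bigr\}\ge 1-\sigma,$$ i.e. $x^{\ast}$ belongs to the closed interval of center $x_{n_\sigma}$ and radius $\varepsilon$ with probability at least $1-\sigma$.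
   Context: Strong mixing coefficients: for a sequence $(\xi_i)_{i\ge1}$ of real random variables, let $\mathcal{F}_l^m$ be the $\sigma$-algebra generated by the $\xi_i$ with $l\le i\le m$ (and $\mathcal{F}_{-\infty}^k$ the one generated by all $\xi_i$ with $i\le k$, $\mathcal{F}_{l}^{+\infty}$ the one generated by all $\xi_i$ with $i\ge l$). Then $$\alpha(n)=\sup_{k}\ \sup_{A\in\mathcal{F}_{-\infty}^{k},\,B\in\mathcal{F}_{k+n}^{+\infty}}\bigl|\mathbb{P}(A\cap B)-\mathbb{P}(A)\mathbb{P}(B)\bigr|.$$ The sequence is called strong mixing ($\alpha$-mixing) if $\alpha(n)\to0$ as $n\to\infty$. *)

(* Defs.v *)
From HB Require Import structures.
From mathcomp Require Import all_boot all_order all_algebra.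
From mathcomp Require Import all_classical all_reals all_analysis.
Set Implicit Arguments.
Unset Strict Implicit.
Unset Printing Implicit Defensive.
Import Order.TTheory GRing.Theory Num.Theory.
Import numFieldNormedType.Exports.
Local Open Scope classical_set_scope.
Local Open Scope ring_scope.

Definition sigma_gen {disp : measure_display} {T : measurableType disp}
    {R : realType} (xi : nat -> T -> R) (I : set nat) : set (set T) :=
  <<s \bigcup_(i in I) g_sigma_algebra_preimage (xi i) >>.

(* Sequences are indexed from 1: [xi 0] never contributes.  The index [k = 0]
   is harmless in the supremum, the past then being the trivial
   sigma-algebra. *)
Definition strong_mixing_coef {disp : measure_display}
    {T : measurableType disp} {R : realType} (P : probability T R)
    (xi : nat -> T -> R) (n : nat) : \bar R :=
  ereal_sup (range (fun k : nat =>
    ereal_sup [set `|P (AB.1 `&` AB.2) - P AB.1 * P AB.2|%E | AB in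
      sigma_gen xi [set i | (1 <= i <= k)%N] `*`
      sigma_gen xi [set i | (1 <= i)%N /\ (k + n <= i)%N]])).

(* Main.v *)
(* Cut the noise at [L + eta * n]: the exceptional probabilities are at most
   [(L + eta * n) ^ -2], whose telescoping majorant has total mass at most
   [1 / (eta * L)].  Off the exceptional event, the distance to the fixed point
   is dominated by a deterministic sequence; while it stays above [eps], each
   step eventually decreases it by at least a constant times [1 / n], which
   cannot go on since the harmonic series diverges. *)
Require Import Defs.
From HB Require Import structures.
From mathcomp Require Import all_boot all_order all_algebra.
From mathcomp Require Import all_classical all_reals all_analysis.
From mathcomp Require Import measurable_realfun ring lra.
Import Order.TTheory GRing.Theory Num.Theory.
Import numFieldNormedType.Exports.
Local Open Scope classical_set_scope.
Local Open Scope ring_scope.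

Lemma lipschitz_continuous (R : realType) (f : R -> R) (c : R) :
  (forall u v, `|f u - f v| <= c * `|u - v|) -> continuous f.
Proof.
move=> fc x; apply/cvgrPdist_le => e e0; near=> y.
apply: (le_trans (fc x y)).
(* The sign of [c] is not known here; [|c| + 1] is a Lipschitz constant by which one can divide. *)
have c1 : 0 < `|c| + 1 by rewrite ltr_wpDl.
apply: (@le_trans _ _ ((`|c| + 1) * `|x - y|)).
  by rewrite ler_wpM2r// (le_trans (ler_norm c))// lerDl.
rewrite -ler_pdivlMl//.
near: y; apply: (@cvgr_dist_le _ _ _ (nbhs x) _ id x) => //.
by rewrite mulr_gt0 ?invr_gt0.
Unshelve. all: by end_near. Qed.

(** If [u] stayed nonnegative, the total decrease from [m0] on would be at most [u m0]. This would
    bound the partial sums of the harmonic series, which diverges. *)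
Lemma harmonic_descent (R : realType) (u : nat -> R) (k : R) (m0 : nat) :
  0 < k -> (forall m, (m0 <= m)%N -> u m.+1 <= u m - k * harmonic m) ->
  exists m, u m < 0.
Proof.
move=> k0 ud; apply: contrapT => /forallNP u0.
have {}u0 m : 0 <= u m by rewrite leNgt; apply/negP/u0.
have S_nd : {homo series (@harmonic R) : m n / (m <= n)%N >-> m <= n}.
  apply/nondecreasing_seqP => n.
  by rewrite seriesSr lerDl harmonic_ge0.
apply: (@dvg_harmonic R); apply: nondecreasing_is_cvgn => //.
exists (k^-1 * u m0 + series harmonic m0) => _ [m _ <-].
apply: (le_trans (S_nd _ _ (leq_addl m0 m))).
rewrite -(ler_pM2l k0) mulrDr mulVKf ?gt_eqF//.
(* From [m0] on, the left-hand side is nonincreasing in the index. *)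
suff : k * series harmonic (m0 + m)%N + u (m0 + m)%N
    <= u m0 + k * series harmonic m0.
  by move=> H; apply: le_trans H; rewrite lerDl.
elim: m => [|m IHm]; first by rewrite addn0 addrC.
rewrite addnS seriesSr; apply: le_trans IHm.
have := ud _ (leq_addr m m0); lra.
Qed.

Section Majorant.
Variables (R : realType) (a c L eta D : R).

(* [majorant m] bounds the distance at time [m.+1]. *)
Fixpoint majorant (m : nat) : R :=
  if m is k.+1 then
    `|1 - a / k.+1%:R| * majorant k
    + a / k.+1%:R * (c * majorant k + k.+1%:R^-1 * (L + eta * k.+1%:R))
  else D.

(** While the majorant [b] is at least [eps], the contraction gains [(1 - c) * b >= (1 - c) * eps],
    in units of [a / m.+1]. The noise eventually costs at most [2 * eta], which is half of that by
    the choice of [eta]; the other half feeds [harmonic_descent]. *)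
Lemma majorant_small (eps : R) : 0 < a -> 0 < c < 1 -> 0 <= L -> 0 < eps ->
  eta = (1 - c) * eps / 4 -> exists m, majorant m < eps.
Proof.
move=> a0 /andP[c0 c1] L0 eps0 etaE.
have eta0 : 0 < eta by rewrite etaE divr_gt0// mulr_gt0// subr_gt0.
(* Past [n1] the factor [1 - a / m.+1] is nonnegative, so its absolute value disappears, and
   [L / m.+1] is at most [eta]. *)
have [n1 n1P] : exists n1 : nat, a <= n1%:R /\ L <= eta * n1%:R.
  exists (Num.truncn (a + L / eta)).+1.
  have lt_n := truncnS_gt (a + L / eta).
  have Le : 0 <= L / eta by rewrite divr_ge0// ltW.
  rewrite [eta * _]mulrC -ler_pdivrMr//; split; lra.
case: (pselect (exists m, majorant m < eps)) => // /forallNP B_ge.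
have {}B_ge m : eps <= majorant m by rewrite leNgt; apply/negP/B_ge.
have k0 : 0 < a * (1 - c) * eps / 2.
  by rewrite divr_gt0// !mulr_gt0// subr_gt0.
have [|m] := @harmonic_descent R majorant _ n1 k0.
  move=> m n1m /=.
  have m0 : 0 < m.+1%:R :> R by rewrite ltr0n.
  have am : a <= m.+1%:R.
    by case: n1P => + _ => /le_trans; apply; rewrite ler_nat ltnW.
  have Lm : L <= eta * m.+1%:R.
    by case: n1P => _ /le_trans; apply; rewrite ler_pM2l// ler_nat ltnW.
  have h0 : 0 < m.+1%:R^-1 :> R by rewrite invr_gt0.
  rewrite ger0_norm ?subr_ge0 ?ler_pdivrMr ?mul1r//.
  have -> : m.+1%:R^-1 * (L + eta * m.+1%:R) = L / m.+1%:R + eta.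
    by rewrite mulrDr mulrCA mulVf ?gt_eqF// mulr1 mulrC.
  have Lh : L / m.+1%:R <= eta by rewrite ler_pdivrMr.
  rewrite /harmonic /=; move: (B_ge m) Lh h0.
  set h := m.+1%:R^-1; set b := majorant m => Bm Lh h0.
  have ah0 : 0 < a * h by rewrite mulr_gt0.
  suff : a * h * (c * b + (L * h + eta))
      <= a * h * (b - (1 - c) * eps / 2) by lra.
  rewrite ler_pM2l//.
  have : (1 - c) * eps <= (1 - c) * b by rewrite ler_pM2l ?subr_gt0.
  lra.
by move=> m_lt; have := B_ge m; lra.
Qed.

End Majorant.

Arguments majorant {R}.

(** With [s = L + eta * m] and [t = s + eta], both at least 1, one has
    [t ^ (- p) <= t ^ (- 2) <= 1 / (s * t)], and the last term equals [(1 / s - 1 / t) / eta]. *)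
Lemma powRN_le_telescope (R : realType) (p L eta : R) (m : nat) :
  2 <= p -> 1 <= L -> 0 < eta ->
  (L + eta * m.+1%:R) `^ (- p)
    <= ((L + eta * m%:R)^-1 - (L + eta * m.+1%:R)^-1) / eta.
Proof.
move=> p2 L1 eta0.
have m0 : 0 <= m%:R :> R by rewrite ler0n.
have em0 : 0 <= eta * m%:R by rewrite mulr_ge0// ltW.
rewrite -natr1 mulrDr mulr1.
have s1 : 1 <= L + eta * m%:R by lra.
move: s1; rewrite addrA; set s := L + eta * m%:R => s1.
have -> : (s^-1 - (s + eta)^-1) / eta = s^-1 * (s + eta)^-1.
  by field; rewrite !gt_eqF//; lra.
have t1 : 1 <= s + eta by lra.
apply: (@le_trans _ _ ((s + eta) `^ (- 2%:R))).
  by rewrite ler_powR// lerN2.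
rewrite powRN powR_mulrn; last lra.
rewrite -invfM lef_pV2 ?posrE; [|nra|nra].
nra.
Qed.

Theorem corollary1 (R : realType) (disp : measure_display)
    (T : measurableType disp) (P : probability T R)
    (f : R -> R) (f_nonlinear : ~ linear (f : R^o -> R^o))
    (a : R) (a_gt0 : 0 < a) (x1 : R)
    (xi : nat -> {RV P >-> R})
    (x : nat -> T -> R)
    (x_init : forall w, x 1%N w = x1)
    (x_rec : forall (n : nat) (w : T), (1 <= n)%N ->
      x n.+1 w = (1 - a / n%:R) * x n w
                 + a / n%:R * (f (x n w) + n%:R^-1 * xi n w))
    (c : R) (c_gt0 : 0 < c) (c_lt1 : c < 1)
    (f_contr : forall u v : R, `|f u - f v| <= c * `|u - v|)
    (xstar : R) (xstar_fix : f xstar = xstar)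
    (N : R) (N_gt0 : 0 < N) (x1_bound : `|x1 - xstar| <= N)
    (p : R) (p_gt2 : 2 < p)
    (xi_tail : forall (t : R) (i : nat), 0 < t -> (1 <= i)%N ->
      (P [set w | (t < `|xi i w|)%R] <= (t `^ (- p))%:E)%E)
    (d beta : R) (d_ge1 : 1 <= d) (beta_gt1 : 1 < beta)
    (xi_mixing : forall n : nat, (1 <= n)%N ->
      (strong_mixing_coef P (fun i : nat => xi i : T -> R) n <= (d * n%:R `^ (- beta))%:E)%E)
    (rho : R) (rho_gt0 : 0 < rho)
    (rho_cond : 2 < rho * ((beta + 1) * p / (beta + p))) :
  forall eps sigma : R, 0 < eps -> 0 < sigma ->
    exists n_sigma : nat, (1 <= n_sigma)%N /\
      ((1 - sigma)%:E <= P [set w | (`|x n_sigma w - xstar| <= eps)%R])%E.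
Proof.
move=> eps sigma eps0 sigma0.
pose eta := (1 - c) * eps / 4.
have eta0 : 0 < eta by rewrite /eta divr_gt0// mulr_gt0// subr_gt0.
(* The second summand makes the total exceptional mass [1 / (eta * L)] at most [sigma]; the 1
   provides the bound [1 <= L] required by [powRN_le_telescope]. *)
pose L := 1 + (eta * sigma)^-1.
have es0 : 0 < (eta * sigma)^-1 by rewrite invr_gt0 mulr_gt0.
have L1 : 1 <= L by rewrite /L; lra.
have L0 : 0 < L by lra.
pose B := majorant a c L eta `|x1 - xstar|.
(* The shift avoids [x 0], which is unconstrained. Measurability passes through [f] because a
   Lipschitz map is continuous. *)
have xm m : measurable_fun [set: T] (x m.+1).
  elim: m => [|m IHm].
    by rewrite (_ : x 1%N = cst x1)//; apply/funext => w; rewrite x_init.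
  rewrite (funext (fun w => x_rec m.+1 w isT)).
  have fm : measurable_fun [set: R] f.
    exact: (continuous_measurable_fun (lipschitz_continuous _ _ _ f_contr)).
  apply: measurable_funD; first by apply: measurable_funM.
  apply: measurable_funM => //; apply: measurable_funD.
    exact: measurableT_comp.
  by apply: measurable_funM.
have dist_m m : measurable_fun [set: T] (fun w => `|x m.+1 w - xstar|).
  by apply: measurableT_comp => //; apply: measurable_funB.
have gt_m (g : T -> R) (t : R) : measurable_fun [set: T] g ->
    measurable [set w | t < g w].
  move=> mg; rewrite -[X in measurable X]setTI.
  exact: (measurable_fun_ltr (measurable_cst t) mg measurableT
    (I : measurable [set true])).
have xi_m i : measurable_fun [set: T] (fun w => `|xi i w|).
  by apply: measurableT_comp.
have step m w : `|xi m.+1 w| <= L + eta * m.+1%:R ->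
    `|x m.+1 w - xstar| <= B m -> `|x m.+2 w - xstar| <= B m.+1.
  move=> xi_le x_le; rewrite x_rec//.
  set h := a / m.+1%:R; set y := x m.+1 w.
  have h0 : 0 < h by rewrite divr_gt0// ltr0n.
  have -> : (1 - h) * y + h * (f y + m.+1%:R^-1 * xi m.+1 w) - xstar =
      (1 - h) * (y - xstar) + h * ((f y - f xstar) + m.+1%:R^-1 * xi m.+1 w).
    by rewrite xstar_fix; ring.
  rewrite [B m.+1]/= -/B -/h; apply: (le_trans (ler_normD _ _)).
  rewrite 2!normrM (gtr0_norm h0) lerD ?ler_wpM2l// ?(ltW h0)//.
  apply: (le_trans (ler_normD _ _)); rewrite lerD//.
    by rewrite (le_trans (f_contr _ _))// ler_wpM2l// ltW.
  by rewrite normrM gtr0_norm ?invr_gt0 ?ltr0n// ler_wpM2l// invr_ge0.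
(* At [m = 0] the event is empty, since [x 1] is constant and [B 0] is its distance to [xstar]. By
   [step], each later event lies in the previous one joined with one large noise value, and the tail
   bounds telescope. *)
have bad m : (P [set w | (B m < `|x m.+1 w - xstar|)%R]
    <= ((L^-1 - (L + eta * m%:R)^-1) / eta)%:E)%E.
  elim: m => [|m IHm].
    rewrite mulr0 addr0 subrr mul0r (_ : mkset _ = set0) ?measure0//.
    by apply/seteqP; split=> // w /=; rewrite x_init ltxx.
  apply: (@le_trans _ _ (P ([set w | B m < `|x m.+1 w - xstar|] `|`
      [set w | L + eta * m.+1%:R < `|xi m.+1 w|]))).
    apply: le_measure; rewrite ?inE; [exact: gt_m| |].
      by apply: measurableU; exact: gt_m.
    move=> w /= Bw; apply: contrapT => /not_orP[/negP + /negP].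
    by rewrite -!leNgt => Bm xim; move: Bw; rewrite ltNge step.
  apply: le_trans (measureU2 _ (gt_m _ _ (dist_m m)) (gt_m _ _ (xi_m m.+1))) _.
  have t0 : 0 < L + eta * m.+1%:R by rewrite ltr_wpDr// mulr_ge0// ltW.
  apply: le_trans (leeD IHm (xi_tail _ m.+1 t0 isT)) _.
  rewrite -EFinD lee_fin.
  have := @powRN_le_telescope R p L eta m (ltW p_gt2) L1 eta0; lra.
have [|m Bm] := @majorant_small R a c L eta `|x1 - xstar| eps
  a_gt0 _ (ltW L0) eps0 erefl.
  by rewrite c_gt0.
exists m.+1; split=> //.
have -> : [set w | `|x m.+1 w - xstar| <= eps] =
    ~` [set w | eps < `|x m.+1 w - xstar|].
  by apply/seteqP; split=> w /=; rewrite leNgt => /negP.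
rewrite probability_setC; last exact: gt_m.
rewrite EFinB leeB//.
apply: (@le_trans _ _ (P [set w | B m < `|x m.+1 w - xstar|])).
  apply: le_measure; rewrite ?inE; [exact: gt_m|exact: gt_m|].
  by move=> w /=; exact: lt_trans.
apply: (le_trans (bad m)); rewrite lee_fin ler_pdivrMr//.
(* The subtracted term of the telescoped sum is dropped; then [L >= (eta * sigma)^-1] concludes. *)
apply: (@le_trans _ _ L^-1).
  by rewrite gerBl invr_ge0 (addr_ge0 (ltW L0))// (mulr_ge0 (ltW eta0)).
rewrite -[leRHS]invrK lef_pV2 ?posrE ?invr_gt0 ?(mulr_gt0 sigma0 eta0)//.
by rewrite /L [sigma * eta]mulrC; lra.
Qed.
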